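(* Let $T\colon\mathsf{Set}\to\mathsf{Set}$ be a functor and let $L$ be a finitarily separable nonexpansive fuzzy lax extension of $T$. Then $L$-behavioural distance coincides with logical distance in quantitative Moss logic: for all $T$-coalgebras $\alpha\colon A\to TA$, $\beta\colon B\to TB$ and all $a\in A$, $b\in B$, $$d^L_{\alpha,\beta}(a,b)=\sup\{[\![\phi]\!](a)\ominus[\![\phi]\!](b)\mid\phi\in\mathcal{L}_L\}.$$
   Context: A fuzzy relation between sets $A$ and $B$ is a map $R\colon A\times B\to[0,1]$; fuzzy relations are ordered pointwise, and the converse is $R^\circ(b,a)=R(a,b)$. For $x,y\in[0,1]$: $x\oplus y=\min(x+y,1)$, $x\ominus y=\max(x-y,0)$. Composition: $(R;S)(a,c)=\inf_{b\in B}R(a,b)\oplus S(b,c)$ (infima and suprema are taken in $[0,1]$). For $f\colon A\to B$ and $\epsilon\in[0,1]$, $\mathrm{Gr}_{\epsilon,f}(a,b)=\epsilon$ if $f(a)=b$ and $1$ otherwise; $\mathrm{Gr}_f=\mathrm{Gr}_{0,f}$, $\Delta_{\epsilon,A}=\mathrm{Gr}_{\epsilon,\mathrm{id}_A}$, $\Delta_A=\Delta_{0,A}$. A fuzzy lax extension $L$ of $T$ assigns to each fuzzy relation $R$ between $A$ and $B$ (for all sets $A,B$) a fuzzy relation $LR$ between $TA$ and $TB$ such that (L1) $R_1\le R_2$ implies $LR_1\le LR_2$; (L2) $L(R;S)\le LR;LS$; (L3) $L\,\mathrm{Gr}_f\le\mathrm{Gr}_{Tf}$ and $L(\mathrm{Gr}_f^\circ)\le\mathrm{Gr}_{Tf}^\circ$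 for every function $f$. It is nonexpansive if $L\Delta_{\epsilon,A}\le\Delta_{\epsilon,TA}$ for all sets $A$ and all $\epsilon>0$. $T_\omega X=\bigcup\{Ti[TY]\mid Y\subseteq X\text{ finite}, i\colon Y\to X\text{ inclusion}\}\subseteq TX$. $L$ is finitarily separable if for every set $X$, every $t\in TX$ and every $\epsilon>0$ there is $s\in T_\omega X$ with $L\Delta_X(t,s)\le\epsilon$ and $L\Delta_X(s,t)\le\epsilon$. Behavioural distance: for coalgebras $\alpha\colon A\to TA$, $\beta\colon B\to TB$, an $L$-simulation is a fuzzy relation $R$ between $A$ and $B$ with $LR(\alpha(a),\beta(b))\le R(a,b)$ for all $a,b$; $d^L_{\alpha,\beta}$ is the pointwise infimum of all $L$-simulations between $A$ and $B$. Quantitative Moss logic: write $\mathcal{Q}X$ for the set of functions $X\to[0,1]$, and let $\in_X$ be the fuzzy relation between $X$ and $\mathcal{Q}X$ given by $\in_X(x,f)=f(x)$. The set $\mathcal{L}_L$ of formulae is defined inductively: it contains all constants $c\in\mathbb{Q}\cap[0,1]$; it is closed under $\phi\ominus c$, $\phi\oplus c$ (for $c\in\mathbb{Q}\cap[0,1]$), $\phi\land\psi$, $\phi\lor\psi$; and for every finite subset $\mathcal{L}_0\subseteq\mathcal{L}_L$ and every $\Phi\in T\mathcal{L}_0$ it contains a formula $\Delta\Phi$. In a coalgebra $(A,\alpha)$, $[\![\phi]\!]\colon A\to[0,1]$ is defined by interpreting $c$ as a constant, $\ominus c$ and $\oplus c$ as the truncated operations above, $\land$ and $\lor$ as pointwise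 minimum and maximum, and $[\![\Delta\Phi]\!](a)=(L{\in_A})(\alpha(a),T[\![-]\!](\Phi))$, where $[\![-]\!]\colon\mathcal{L}_0\to\mathcal{Q}A$ is the semantics map on $\mathcal{L}_0$. In the claim, formulae are evaluated at $a$ in $(A,\alpha)$ and at $b$ in $(B,\beta)$. *)

(* Defs.v *)
From HB Require Import structures.
From mathcomp Require Import all_boot all_order all_algebra interval_inference.
From mathcomp Require Import all_classical all_reals.

Set Implicit Arguments.
Unset Strict Implicit.
Unset Printing Implicit Defensive.
Import Order.TTheory GRing.Theory Num.Theory.
Local Open Scope classical_set_scope.
Local Open Scope ring_scope.

Section UnitInterval.
Variable R : realType.
Implicit Types (x y : {i01 R}) (S : set {i01 R}).

Definition oplus x y : {i01 R} := (Num.min (x%:num + y%:num) 1)%:i01.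
Definition ominus x y : {i01 R} := (Num.max (x%:num - y%:num) 0)%:i01.

(* Infima and suprema are those of the complete lattice [0,1]: the bound added
   to the set makes inf01 set0 = 1 and sup01 set0 = 0, whereas the library's
   inf and sup of the empty set of reals are both 0. *)
Let inf_set S : set R := 1 |` [set x%:num | x in S].
Let sup_set S : set R := 0 |` [set x%:num | x in S].

Fact inf_set_lb S : lbound (inf_set S) 0.
Proof. by move=> _ [->|[x _ <-]]. Qed.

Fact sup_set_ub S : ubound (sup_set S) 1.
Proof. by move=> _ [->|[x _ <-]]. Qed.

Fact inf_set_ge0 S : 0 <= inf (inf_set S).
Proof. by apply: lb_le_inf; [exists 1; left|exact: inf_set_lb]. Qed.

Fact inf_set_le1 S : inf (inf_set S) <= 1.
Proof. by apply: ge_inf; [exists 0; exact: inf_set_lb|left]. Qed.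

Fact sup_set_ge0 S : 0 <= sup (sup_set S).
Proof. by apply: ub_le_sup; [exists 1; exact: sup_set_ub|left]. Qed.

Fact sup_set_le1 S : sup (sup_set S) <= 1.
Proof. by apply: ge_sup; [exists 0; left|exact: sup_set_ub]. Qed.

Definition inf01 S : {i01 R} := Itv01 (inf_set_ge0 S) (inf_set_le1 S).
Definition sup01 S : {i01 R} := Itv01 (sup_set_ge0 S) (sup_set_le1 S).

Lemma inf01_lb S x : S x -> inf01 S <= x.
Proof.
move=> Sx; change (inf (inf_set S) <= x%:num).
by apply: ge_inf; [exists 0; exact: inf_set_lb|right; exists x].
Qed.

Lemma inf01_glb S x : (forall y, S y -> x <= y) -> x <= inf01 S.
Proof.
move=> xS; change (x%:num <= inf (inf_set S)).
apply: lb_le_inf; first by exists 1; left.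
by move=> _ [->//|[y Sy <-]]; exact: xS.
Qed.

Lemma sup01_ub S x : S x -> x <= sup01 S.
Proof.
move=> Sx; change (x%:num <= sup (sup_set S)).
by apply: ub_le_sup; [exists 1; exact: sup_set_ub|right; exists x].
Qed.

Lemma sup01_lub S x : (forall y, S y -> y <= x) -> sup01 S <= x.
Proof.
move=> xS; change (sup (sup_set S) <= x%:num).
apply: ge_sup; first by exists 0; left.
by move=> _ [->//|[y Sy <-]]; exact: xS.
Qed.

Fact ratr01_ge0 (c : {i01 rat}) : 0 <= ratr c%:num :> R.
Proof. by rewrite ler0q. Qed.

Fact ratr01_le1 (c : {i01 rat}) : ratr c%:num <= 1 :> R.
Proof. by rewrite -[leRHS](rmorph1 ratr) ler_rat. Qed.

Definition rat01 (c : {i01 rat}) : {i01 R} :=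
  Itv01 (ratr01_ge0 c) (ratr01_le1 c).

End UnitInterval.

(* Functors from sets to sets, types playing the role of sets. *)

Record functor := Functor {
  fobj :> Type -> Type ;
  fmap : forall A B : Type, (A -> B) -> fobj A -> fobj B ;
  fmap_id : forall (A : Type) (t : fobj A), fmap (fun x : A => x) t = t ;
  fmap_comp : forall (A B C : Type) (g : B -> C) (f : A -> B) (t : fobj A),
    fmap (fun x => g (f x)) t = fmap g (fmap f t) }.
Arguments fmap T {A B} f t : rename.

Section FuzzyRelations.
Variable R : realType.

Definition fuzzy_rel (A B : Type) : Type := A -> B -> {i01 R}.

Definition frel_le (A B : Type) (R1 R2 : fuzzy_rel A B) : Prop :=
  forall a b, R1 a b <= R2 a b.

Definition conv (A B : Type) (R1 : fuzzy_rel A B) : fuzzy_rel B A :=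
  fun b a => R1 a b.

Definition fcomp (A B C : Type) (R1 : fuzzy_rel A B) (R2 : fuzzy_rel B C) :
    fuzzy_rel A C :=
  fun a c => inf01 [set oplus (R1 a b) (R2 b c) | b in [set: B]].

Definition graph_eps (A B : Type) (e : {i01 R}) (f : A -> B) : fuzzy_rel A B :=
  fun a b => if `[< f a = b >] then e else 1%:i01.

Definition graph (A B : Type) (f : A -> B) : fuzzy_rel A B :=
  graph_eps 0%:i01 f.

Definition diag_eps (A : Type) (e : {i01 R}) : fuzzy_rel A A :=
  graph_eps e (fun a : A => a).
Arguments diag_eps A e : clear implicits.

Definition diag (A : Type) : fuzzy_rel A A := diag_eps A 0%:i01.
Arguments diag A : clear implicits.

Definition membership (A : Type) : fuzzy_rel A (A -> {i01 R}) := fun x f => f x.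
Arguments membership A : clear implicits.

Record fuzzy_lax_extension (T : functor) := FuzzyLaxExtension {
  lift : forall A B : Type, fuzzy_rel A B -> fuzzy_rel (T A) (T B) ;
  lift_mono : forall (A B : Type) (R1 R2 : fuzzy_rel A B),
    frel_le R1 R2 -> frel_le (lift R1) (lift R2) ;
  lift_comp : forall (A B C : Type) (R1 : fuzzy_rel A B) (R2 : fuzzy_rel B C),
    frel_le (lift (fcomp R1 R2)) (fcomp (lift R1) (lift R2)) ;
  lift_graph : forall (A B : Type) (f : A -> B),
    frel_le (lift (graph f)) (graph (fmap T f)) ;
  lift_graph_conv : forall (A B : Type) (f : A -> B),
    frel_le (lift (conv (graph f))) (conv (graph (fmap T f))) }.
Arguments lift {T} L {A B} _ : rename.

Definition nonexpansive (T : functor) (L : fuzzy_lax_extension T) : Prop :=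
  forall (A : Type) (e : {i01 R}), 0 < e%:num ->
    frel_le (lift L (diag_eps A e)) (diag_eps (T A) e).

(* The elements of T X coming from T Y for some finite subset Y of X. *)
Definition finitary_part (T : functor) (X : Type) : set (T X) :=
  [set t | exists Y : set X,
     finite_set Y /\ exists u : T (set_type Y), t = fmap T set_val u].

Definition finitarily_separable (T : functor) (L : fuzzy_lax_extension T) :
    Prop :=
  forall (X : Type) (t : T X) (e : R), 0 < e ->
    exists2 s : T X, finitary_part s &
      (lift L (diag X) t s)%:num <= e /\ (lift L (diag X) s t)%:num <= e.

Definition simulation (T : functor) (L : fuzzy_lax_extension T) (A B : Type)
    (alpha : A -> T A) (beta : B -> T B) : set (fuzzy_rel A B) :=
  [set S | forall a b, lift L S (alpha a) (beta b) <= S a b].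

Definition behavioural_distance (T : functor) (L : fuzzy_lax_extension T)
    (A B : Type) (alpha : A -> T A) (beta : B -> T B) : fuzzy_rel A B :=
  fun a b => inf01 [set S a b | S in simulation L alpha beta].

End FuzzyRelations.

Arguments diag_eps {R} A e.
Arguments diag {R} A.
Arguments membership {R} A.
Arguments lift {R T} L {A B} _ : rename.

Record enumeration (X : Type) := Enumeration {
  enum_size : nat ;
  enum_elt : 'I_enum_size -> X ;
  enum_idx : X -> 'I_enum_size ;
  enum_idxK : cancel enum_idx enum_elt ;
  enum_eltK : cancel enum_elt enum_idx }.

Lemma finite_set_enumeration (X : Type) (Y : set X) :
  finite_set Y -> inhabited (enumeration (set_type Y)).
Proof.
case=> n /card_set_bijP[f [fY finj fsurj]].
have fltn (x : set_type Y) : (f (set_val x) < n)%N.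
  by apply: fY; exact: set_valP.
have /choice[g gP] : forall i : 'I_n, exists x : set_type Y, f (set_val x) = i.
  move=> i; have [x Yx fx] := fsurj i (ltn_ord i).
  by exists (SigSub (mem_set Yx)).
have idxK : cancel (fun x => Ordinal (fltn x)) g.
  move=> x; apply/val_inj/finj; rewrite ?inE; try exact: set_valP.
  exact: gP.
have eltK : cancel g (fun x => Ordinal (fltn x)).
  by move=> i; apply/val_inj; exact: gP.
by exact: (inhabits (Enumeration idxK eltK)).
Qed.

Definition enumerate (X : Type) (Y : set X) (fin : finite_set Y) :
    enumeration (set_type Y) :=
  inhabited_witness (finite_set_enumeration fin).

(* Formulae as terms.  The argument of the Moss modality is an element of T L0
   for a finite set L0 of formulae.  As T is an arbitrary functor, T applied to
   a set of terms is not a legal constructor argument (it is not strictly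
   positive), so L0 is presented by a family phi indexed by 'I_n and the element
   of T L0 by an element of T 'I_n.  The set of formulae is then moss_formula
   below, whose modality really ranges over finite sets of formulae. *)
Inductive moss_term (T : functor) : Type :=
| MConst of {i01 rat}
| MMinus of moss_term T & {i01 rat}
| MPlus of moss_term T & {i01 rat}
| MAnd of moss_term T & moss_term T
| MOr of moss_term T & moss_term T
| MDelta (n : nat) (phi : 'I_n -> moss_term T) (Phi : T 'I_n).

Arguments MConst {T}.

(* The term for an element Phi of T L0, L0 being finite: Phi is transported
   along the bijection of L0 with 'I_n chosen by enumerate.  By sem_moss_delta
   its semantics does not depend on that choice. *)
Definition moss_delta (T : functor) (L0 : set (moss_term T))
    (fin : finite_set L0) (Phi : T (set_type L0)) : moss_term T :=
  let e := enumerate fin in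
  MDelta (fun i : 'I_(enum_size e) => set_val (enum_elt i))
    (fmap T (enum_idx e) Phi).

Inductive moss_formula (T : functor) : set (moss_term T) :=
| moss_const c : moss_formula (MConst c)
| moss_minus phi c : moss_formula phi -> moss_formula (MMinus phi c)
| moss_plus phi c : moss_formula phi -> moss_formula (MPlus phi c)
| moss_and phi psi :
    moss_formula phi -> moss_formula psi -> moss_formula (MAnd phi psi)
| moss_or phi psi :
    moss_formula phi -> moss_formula psi -> moss_formula (MOr phi psi)
| moss_modal (L0 : set (moss_term T)) (fin : finite_set L0)
    (Phi : T (set_type L0)) :
    (forall phi, L0 phi -> moss_formula phi) ->
    moss_formula (moss_delta fin Phi).

Fixpoint sem (R : realType) (T : functor) (L : fuzzy_lax_extension R T)
    (A : Type) (alpha : A -> T A) (phi : moss_term T) {struct phi} :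
    A -> {i01 R} :=
  match phi with
  | MConst c => fun=> rat01 R c
  | MMinus psi c => fun a => ominus (sem L alpha psi a) (rat01 R c)
  | MPlus psi c => fun a => oplus (sem L alpha psi a) (rat01 R c)
  | MAnd psi chi => fun a => Num.min (sem L alpha psi a) (sem L alpha chi a)
  | MOr psi chi => fun a => Num.max (sem L alpha psi a) (sem L alpha chi a)
  | MDelta n psi Phi => fun a =>
      lift L (membership A) (alpha a)
        (fmap T (fun i => sem L alpha (psi i)) Phi)
  end.

Lemma sem_moss_delta (R : realType) (T : functor)
    (L : fuzzy_lax_extension R T) (A : Type) (alpha : A -> T A)
    (L0 : set (moss_term T)) (fin : finite_set L0) (Phi : T (set_type L0))
    (a : A) :
  sem L alpha (moss_delta fin Phi) a =
  lift L (membership A) (alpha a)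
    (fmap T (fun phi : set_type L0 => sem L alpha (set_val phi)) Phi).
Proof.
rewrite /= -fmap_comp; congr (lift L _ _ (fmap T _ Phi)).
by apply/funext => phi; rewrite enum_idxK.
Qed.

(* Main.v *)
Require Import Defs.
From mathcomp Require Import all_boot all_order all_algebra interval_inference.
From mathcomp Require Import all_classical all_reals.
From mathcomp Require Import lra.

(* Every simulation bounds the logical distance d: naturality turns the Moss
   modality into L E_A for the relation E_A(x, i) = [[phi_i]](x), and a
   simulation S satisfies E_A <= S ; E_B by induction.  Conversely d is itself a
   simulation.  By finitary separability, alpha a and beta b are replaced up to
   eps by elements coming from finite sets X and Y.  For each y in Y a finite
   maximum of formulae, shifted by rational constants, yields phi_y vanishing at
   y with phi_y >= d(-, y) - eps on X.  The modality applied to (phi_y)_y then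
   has value at most eps at b and, L being nonexpansive, at least
   L d (alpha a, beta b) - 4 eps at a. *)

Set Implicit Arguments.
Unset Strict Implicit.
Unset Printing Implicit Defensive.
Import Order.TTheory GRing.Theory Num.Theory.
Local Open Scope classical_set_scope.
Local Open Scope ring_scope.

(* Both names are shadowed by the libraries imported after [Defs]. *)
Local Notation lift := Defs.lift.
Local Notation fmap := Defs.fmap.

(** * Truncated arithmetic and approximation in the unit interval *)

Section UnitIntervalTheory.
Variable R : realType.
Implicit Types x y z e : {i01 R}.

(** Settles the cases off a graph or diagonal, where the relation has value 1. *)
Lemma i01_le_add1 x y : x%:num <= y%:num + 1.
Proof.
have x_le1 : x%:num <= 1 by [].
have y_ge0 : 0 <= y%:num by [].
lra.
Qed.

Lemma le_oplus x y z : (z <= oplus x y) = (z%:num <= x%:num + y%:num).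
Proof. by rewrite -num_le /oplus /= le_min le1 andbT. Qed.

Lemma ominus_le x y z : (ominus x y <= z) = (x%:num <= y%:num + z%:num).
Proof. by rewrite -num_le /ominus /= ge_max lerBlDl ge0 andbT. Qed.

Lemma ominus_ge x y : x%:num - y%:num <= (ominus x y)%:num.
Proof. by rewrite /ominus /= le_max lexx. Qed.

Lemma ominus_le_approx x y z e : z%:num <= y%:num + e%:num ->
  (ominus x y)%:num <= (ominus x z)%:num + e%:num.
Proof.
move=> z_le; have xz := ominus_ge x z.
have xz0 : 0 <= (ominus x z)%:num by [].
have e0 : 0 <= e%:num by [].
by rewrite [leLHS]/= ge_max; apply/andP; split; lra.
Qed.

Lemma le_ominus x y z :
  (z <= ominus x y) = (z%:num <= x%:num - y%:num) || (z%:num <= 0).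
Proof. by rewrite -num_le /ominus /= le_max. Qed.

Lemma i01_le0 x : x <= 0%:i01 -> x%:num = 0.
Proof. by move=> x_le0; apply/le_anti; rewrite ge0 andbT; exact: x_le0. Qed.

Lemma sup01_approx (S : set {i01 R}) e : S !=set0 -> 0 < e%:num ->
  exists2 x, S x & (sup01 S)%:num <= x%:num + e%:num.
Proof.
move=> [x0 Sx0] e_gt0; apply: contrapT => no_x.
have x_lt x : S x -> x%:num + e%:num < (sup01 S)%:num.
  by move=> Sx; rewrite ltNge; apply/negP => ?; apply: no_x; exists x.
have : sup01 S <= ominus (sup01 S) e.
  apply: sup01_lub => x /x_lt xe.
  by rewrite le_ominus; apply/orP; left; lra.
(* The element [x0] makes the supremum positive, which excludes the case where the subtraction of
   [e] is truncated at 0. *)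
have x0_ge0 : 0 <= x0%:num by [].
by have := x_lt _ Sx0; rewrite le_ominus => ? /orP[]; lra.
Qed.

Lemma rat01_approx x e : 0 < e%:num ->
  exists2 c : {i01 rat}, x%:num <= (rat01 R c)%:num &
    (rat01 R c)%:num <= x%:num + e%:num.
Proof.
move=> e_gt0; have ratr1 : ratr 1 = 1 :> R := rmorph1 _.
have : x%:num <= 1 by [].
rewrite le_eqVlt => /predU1P[x1|x_lt1].
  (* At [x] = 1 the open interval used below is empty, so 1 itself is chosen. *)
  by exists 1%:i01; rewrite /rat01 /= ratr1; lra.
have [q] : exists q : rat, ratr q \in `]x%:num, (Num.min 1 (x%:num + e%:num))[.
  by apply: rat_in_itvoo; rewrite lt_min x_lt1 ltrDl.
rewrite in_itv /= lt_min => /and3P[xq q1 qe].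
have q0 : 0 <= q by rewrite -(ler0q R) (le_trans _ (ltW xq)).
have q1' : q <= 1 by rewrite -(ler_rat R) ratr1 ltW.
by exists (Itv01 q0 q1'); rewrite /rat01 /= ltW.
Qed.

Lemma le_i01_addgt0 (k : nat) (x y : R) :
  (forall e, 0 < e%:num -> x <= y + k%:R * e%:num) -> x <= y.
Proof.
move=> H; apply/ler_addgt0Pr => d d_gt0.
(* Dividing by [k.+1] covers [k] = 0; the minimum with 1 keeps the chosen epsilon in the unit
   interval. *)
have k_gt0 : 0 < k.+1%:R :> R by [].
have m_gt0 : 0 < Num.min 1 (d / k.+1%:R) by rewrite lt_min ltr01 divr_gt0.
have m_le1 : Num.min 1 (d / k.+1%:R) <= 1 by rewrite ge_min lexx.
apply: (le_trans (H (Itv01 (ltW m_gt0) m_le1) m_gt0)); rewrite /= lerD2l.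
apply: (@le_trans _ _ (k.+1%:R * (d / k.+1%:R))); last first.
  by rewrite mulrCA divff ?mulr1 ?gt_eqF.
by apply: ler_pM; rewrite ?ler_nat ?ge_min ?lexx ?orbT // ltW.
Qed.

End UnitIntervalTheory.

(** * Triangle inequalities and naturality of lax extensions *)

Section LaxExtensionTheory.
Variables (R : realType) (T : functor) (L : fuzzy_lax_extension R T).

Lemma graphE (A B : Type) (f : A -> B) a : graph R f a (f a) = 0%:i01.
Proof. by rewrite /graph /graph_eps asboolT. Qed.

(** The hypothesis says that [S] lies below [fcomp R1 R2], so monotonicity and lax composition
    apply, with [u] as the midpoint bounding the infimum. *)
Lemma lift_triangle (A B C : Type) (S : fuzzy_rel R A C) (R1 : fuzzy_rel R A B)
    (R2 : fuzzy_rel R B C) :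
  (forall a b c, (S a c)%:num <= (R1 a b)%:num + (R2 b c)%:num) ->
  forall t u v,
    (lift L S t v)%:num <= (lift L R1 t u)%:num + (lift L R2 u v)%:num.
Proof.
move=> S_le t u v; rewrite -le_oplus.
have S_le_comp : frel_le S (fcomp R1 R2).
  by move=> a c; apply: inf01_glb => _ [b _ <-]; rewrite le_oplus.
apply: le_trans (lift_mono L S_le_comp t v) _.
apply: le_trans (lift_comp L R1 R2 t v) _.
by apply: inf01_lb; exists u.
Qed.

Lemma lift_graph_fmap (A B : Type) (f : A -> B) t :
  (lift L (graph R f) t (fmap T f t))%:num = 0.
Proof.
apply/le_anti; rewrite ge0 andbT.
by have := lift_graph L f t (fmap T f t); rewrite graphE.
Qed.

Lemma lift_graph_conv_fmap (A B : Type) (f : A -> B) t :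
  (lift L (conv (graph R f)) (fmap T f t) t)%:num = 0.
Proof.
apply/le_anti; rewrite ge0 andbT.
by have := lift_graph_conv L f (fmap T f t) t; rewrite /conv graphE.
Qed.

(** Naturality: each inequality is a triangle through the graph of [g] or its converse, whose lift
    vanishes between [u] and [fmap T g u]. *)
Lemma lift_fmapr (A B C : Type) (S : fuzzy_rel R A C) (g : B -> C) t u :
  lift L (fun a b => S a (g b)) t u = lift L S t (fmap T g u).
Proof.
apply/le_anti; rewrite -!num_le; apply/andP; split.
  rewrite -[leRHS]addr0 -(lift_graph_conv_fmap g u); apply: lift_triangle.
  move=> a c b; rewrite /conv /graph /graph_eps.
  by case: asboolP => [->|_] /=; rewrite ?addr0 ?i01_le_add1.
rewrite -[leRHS]addr0 -(lift_graph_fmap g u); apply: lift_triangle.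
move=> a b c; rewrite /graph /graph_eps.
by case: asboolP => [->|_] /=; rewrite ?addr0 ?i01_le_add1.
Qed.

Lemma lift_fmapl (A B C : Type) (S : fuzzy_rel R B C) (f : A -> B) t u :
  lift L (fun a c => S (f a) c) t u = lift L S (fmap T f t) u.
Proof.
apply/le_anti; rewrite -!num_le; apply/andP; split.
  rewrite -[leRHS]add0r -(lift_graph_fmap f t); apply: lift_triangle.
  move=> a b c; rewrite /graph /graph_eps.
  by case: asboolP => [->|_] /=; rewrite ?add0r // addrC i01_le_add1.
rewrite -[leRHS]add0r -(lift_graph_conv_fmap f t); apply: lift_triangle.
move=> b a c; rewrite /conv /graph /graph_eps.
by case: asboolP => [->|_] /=; rewrite ?add0r // addrC i01_le_add1.
Qed.

(** Replacing an argument costs a lifted diagonal, the quantity that finitary separability makes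
    small. *)
Lemma lift_diagl (A B : Type) (S : fuzzy_rel R A B) t t' u :
  (lift L S t u)%:num <= (lift L (diag A) t t')%:num + (lift L S t' u)%:num.
Proof.
apply: lift_triangle => a a' b; rewrite /diag /diag_eps /graph_eps.
by case: asboolP => [->|_] /=; rewrite ?add0r // addrC i01_le_add1.
Qed.

Lemma lift_diagr (A B : Type) (S : fuzzy_rel R A B) t u u' :
  (lift L S t u)%:num <= (lift L S t u')%:num + (lift L (diag B) u' u)%:num.
Proof.
apply: lift_triangle => a b' b; rewrite /diag /diag_eps /graph_eps.
by case: asboolP => [->|_] /=; rewrite ?addr0 ?i01_le_add1.
Qed.

(** [S] lies below [S'] composed with [diag_eps B e], whose lift is at most [e] at [(u, u)]. *)
Lemma nonexpansive_lift (Lne : nonexpansive L) (A B : Type)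
    (S S' : fuzzy_rel R A B) (e : {i01 R}) : 0 < e%:num ->
  (forall a b, (S a b)%:num <= (S' a b)%:num + e%:num) ->
  forall t u, (lift L S t u)%:num <= (lift L S' t u)%:num + e%:num.
Proof.
move=> e_gt0 SS' t u.
have Le := Lne B e e_gt0 u u; rewrite /diag_eps /graph_eps asboolT // in Le.
apply: (@le_trans _ _
  ((lift L S' t u)%:num + (lift L (diag_eps B e) u u)%:num)).
  apply: lift_triangle => a b' b; rewrite /diag_eps /graph_eps.
  by case: asboolP => [->|_] /=; rewrite ?SS' ?i01_le_add1.
by rewrite lerD2l.
Qed.

(** * Comparison of the two distances *)

Section Coalgebras.
Variables (A B : Type) (alpha : A -> T A) (beta : B -> T B).

Lemma sem_simulation (S : fuzzy_rel R A B) : simulation L alpha beta S ->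
  forall phi a b,
    (sem L alpha phi a)%:num <= (sem L beta phi b)%:num + (S a b)%:num.
Proof.
move=> Ssim; elim=>
  [c|phi IH c|phi IH c|phi IH1 psi IH2|phi IH1 psi IH2|n phi IH Phi] a b /=.
- by rewrite lerDl.
- have := IH a b; have : 0 <= (S a b)%:num by [].
  rewrite ge_max => ? ?.
  have : (sem L beta phi b)%:num - ratr c%:num <=
    Num.max ((sem L beta phi b)%:num - ratr c%:num) 0 by rewrite le_max lexx.
  have : 0 <= Num.max ((sem L beta phi b)%:num - ratr c%:num) 0.
    by rewrite le_max lexx orbT.
  by move=> *; apply/andP; split; lra.
- have := IH a b; have : 0 <= (S a b)%:num by [] => ? ?.
  rewrite -lerBlDr le_min; apply/andP; split; rewrite lerBlDr ge_min; apply/orP.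
    by left; lra.
  by right; lra.
- case: (leP (sem L beta phi b)) => _;
    [apply: le_trans (IH1 a b)|apply: le_trans (IH2 a b)];
    by rewrite num_le ge_min lexx ?orbT.
- case: (leP (sem L alpha phi a)) => _.
    by apply: (le_trans (IH2 a b)); rewrite lerD2r num_le le_max lexx orbT.
  by apply: (le_trans (IH1 a b)); rewrite lerD2r num_le le_max lexx.
- rewrite -!lift_fmapr.
  (* After naturality both modalities are lifts evaluated at [Phi]; the induction hypothesis is the
     triangle condition, with midpoint [beta b]. *)
  apply: (le_trans (lift_triangle (R1 := S)
    (R2 := fun b i => sem L beta (phi i) b) _ _ (beta b) _)).
    by move=> a' b' i; rewrite addrC; exact: IH.
  by rewrite addrC lerD2l; exact: Ssim.
Qed.

Definition logical_distance : fuzzy_rel R A B := fun a b =>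
  sup01 [set ominus (sem L alpha phi a) (sem L beta phi b)
        | phi in @moss_formula T].

Lemma logical_distance_le_behavioural :
  frel_le logical_distance (behavioural_distance L alpha beta).
Proof.
move=> a b; apply: inf01_glb => _ [S Ssim <-].
apply: sup01_lub => _ [phi _ <-].
by rewrite ominus_le; exact: sem_simulation.
Qed.

(** Half of [e] pays for a nearly optimal formula, half for a rational [c] just above its value at
    [b]; subtracting [c] gives 0 at [b]. *)
Lemma separating_formula a b (e : {i01 R}) : 0 < e%:num ->
  exists phi, [/\ moss_formula phi, (sem L beta phi b)%:num = 0 &
    (logical_distance a b)%:num <= (sem L alpha phi a)%:num + e%:num].
Proof.
move=> e_gt0.
have h_ge0 : 0 <= e%:num / 2 by rewrite divr_ge0.
have h_le1 : e%:num / 2 <= 1.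
  have : e%:num <= 1 by [].
  lra.
pose h := Itv01 h_ge0 h_le1.
have h_gt0 : 0 < h%:num by rewrite divr_gt0.
have hE : h%:num = e%:num / 2 by [].
have [||_ [phi phiF <-] d_le] := @sup01_approx R
  [set ominus (sem L alpha phi a) (sem L beta phi b) | phi in @moss_formula T] h.
- by exists (ominus (sem L alpha (MConst 0%:i01) a)
    (sem L beta (MConst 0%:i01) b)), (MConst 0%:i01) => //; exact: moss_const.
- exact: h_gt0.
have [c phi_le_c c_le] := rat01_approx (sem L beta phi b) h_gt0.
exists (MMinus phi c); split; first exact: moss_minus.
  by apply/le_anti; rewrite ge0 andbT /= ge_max subr_le0 lexx andbT.
apply: (le_trans d_le).
have := ominus_le_approx (sem L alpha phi a) c_le.
by rewrite [sem L alpha (MMinus _ _) a]/=; lra.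
Qed.

Lemma separating_formula_finite (X : set A) b (e : {i01 R}) :
  finite_set X -> 0 < e%:num ->
  exists phi, [/\ moss_formula phi, (sem L beta phi b)%:num = 0 &
    forall a, X a ->
      (logical_distance a b)%:num <= (sem L alpha phi a)%:num + e%:num].
Proof.
move=> /finite_set_enumeration[en] e_gt0.
have /choice[phi phiP] := fun i : 'I_(enum_size en) =>
  separating_formula (set_val (enum_elt i)) b e_gt0.
(* The constant formula 0 is the unit of the finite maximum, so an empty [X] is covered. *)
have rat0 : rat01 R 0%:i01 = 0%:i01 by apply: val_inj; rewrite /= rmorph0.
have semE C (gamma : C -> T C) c :
    sem L gamma (\big[@MOr T/MConst 0%:i01]_i phi i) c =
    \big[Num.max/0%:i01]_i sem L gamma (phi i) c.
  exact: (@big_morph _ _ (fun psi => sem L gamma psi c)).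
exists (\big[@MOr T/MConst 0%:i01]_i phi i); split.
- apply: big_ind => [|psi chi|i _]; [exact: moss_const|exact: moss_or|].
  by case: (phiP i).
- rewrite semE; apply: i01_le0; apply: bigmax_le => // i _.
  have [_ phi0 _] := phiP i.
  by have : (sem L beta (phi i) b)%:num <= 0 by rewrite phi0.
- move=> a Xa; pose x : set_type X := SigSub (mem_set Xa).
  have [_ _] := phiP (enum_idx en x); rewrite enum_idxK => /le_trans-> //.
  rewrite lerD2r num_le semE.
  exact: (le_bigmax _ (fun i => sem L alpha (phi i) a)).
Qed.

Lemma logical_distance_simulation :
  finitarily_separable L -> nonexpansive L ->
  simulation L alpha beta logical_distance.
Proof.
move=> Lsep Lne a b; rewrite -num_le.
(* Four errors come from finite approximation, in both directions at [alpha a] and at [beta b]; the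
   fifth comes from the separating formulae. *)
apply: (@le_i01_addgt0 _ 5) => e e_gt0.
have [_ [X [finX [u ->]]] [a_u u_a]] := Lsep A (alpha a) _ e_gt0.
have [_ [Y [finY [v ->]]] [b_v v_b]] := Lsep B (beta b) _ e_gt0.
have /choice[phi phiP] := fun y => separating_formula_finite y finX e_gt0.
(* Along [g], [v] becomes an element over the finite set of formulae [phi y], a legal argument of
   the modality. *)
pose g (y : set_type Y) : set_type (phi @` Y) :=
  SigSub (mem_set (imageP phi (set_valP y))).
pose psi := moss_delta (finite_image phi finY) (fmap T g v).
have psiF : moss_formula psi.
  by apply: moss_modal => _ [y _ <-]; have [] := phiP y.
pose E C (gamma : C -> T C) c (y : set_type Y) :=
  sem L gamma (phi (set_val y)) c.
have semE C (gamma : C -> T C) c :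
    sem L gamma psi c = lift L (E C gamma) (gamma c) v.
  by rewrite sem_moss_delta -Defs.fmap_comp -lift_fmapr.
have psi_le : (sem L alpha psi a)%:num <=
    (sem L beta psi b)%:num + (logical_distance a b)%:num.
  by rewrite -ominus_le; apply: sup01_ub; exists psi.
rewrite !semE in psi_le.
have := lift_diagr logical_distance (alpha a) (beta b) (fmap T set_val v).
have := lift_diagl logical_distance (alpha a) (fmap T set_val u)
  (fmap T set_val v).
have : (lift L logical_distance (fmap T set_val u) (fmap T set_val v))%:num <=
    (lift L (E A alpha) (fmap T set_val u) v)%:num + e%:num.
  (* Both relations are pulled back to [X] and [Y], since [phi y] is controlled only on [X]. *)
  rewrite -lift_fmapr -!lift_fmapl; apply: nonexpansive_lift => // x y.
  by have [_ _ phi_ge] := phiP (set_val y); apply: phi_ge; exact: set_valP.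
have := lift_diagl (E A alpha) (fmap T set_val u) (alpha a) v.
(* As [phi y] vanishes at [y], [E B beta] lies below the converse graph of the
   inclusion of [Y]. *)
have : (lift L (E B beta) (beta b) v)%:num <=
    (lift L (diag B) (beta b) (fmap T set_val v))%:num +
    (lift L (conv (graph R set_val)) (fmap T set_val v) v)%:num.
  apply: lift_triangle => c c' y.
  rewrite /diag /diag_eps /conv /graph /graph_eps.
  case: asboolP => [->|_]; last by rewrite addrC i01_le_add1.
  case: asboolP => [<-|_]; last by rewrite i01_le_add1.
  by have [_ + _] := phiP (set_val y); rewrite /E => ->; rewrite addr0.
rewrite lift_graph_conv_fmap; lra.
Qed.

End Coalgebras.
End LaxExtensionTheory.

Theorem corollary8p11 (R : realType) (T : functor)
    (L : fuzzy_lax_extension R T)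
    (Lsep : finitarily_separable L) (Lne : nonexpansive L)
    (A B : Type) (alpha : A -> T A) (beta : B -> T B) (a : A) (b : B) :
  behavioural_distance L alpha beta a b =
  sup01 [set ominus (sem L alpha phi a) (sem L beta phi b)
        | phi in @moss_formula T].
Proof.
apply/le_anti/andP; split; last exact: logical_distance_le_behavioural.
apply: inf01_lb; exists (logical_distance L alpha beta) => //.
exact: logical_distance_simulation.
Qed.
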